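(* For integers $n_1,n_2\ge 2$, let $g_{n_1,n_2}$ denote the number of standard Young tableaux of truncated shifted shape with $n_1$ rows and $n_2$ boxes in each row, and set by convention $g_{3,1}:=1$. Then for all $n\ge 1$, $$g_{3,n+1}=-g_{3,n}+\frac{7n+1}{n^2(n+1)^2}\binom{2n-2}{n-1}\binom{3n}{n-1}.$$
   Context: The truncated shifted shape with $n_1$ rows and $n_2$ boxes in each row is the set of boxes $(i,c)$ with $1\le i\le n_1$ and $i\le c\le i+n_2-1$ (row $i$ consists of $n_2$ consecutive boxes starting in column $i$); equivalently it is the shifted diagram of $(n_1+n_2-1,n_1+n_2-2,\dots,n_2)$ with the staircase $(n_1-1,\dots,1)$ removed from its north-east corner. A standard Young tableau of this shape is a bijective labeling of its $n_1n_2$ boxes by $\{1,2,\dots,n_1n_2\}$ such that labels increase from left to right along each row and from top to bottom along each column. *)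

(* Defs.v *)
From mathcomp Require Import all_boot all_order all_algebra.
Set Implicit Arguments.
Unset Strict Implicit.
Unset Printing Implicit Defensive.

(* Rows and columns are numbered from 0: row i occupies the columns
   i, ..., i + n2 - 1.  The bound n1 + n2 on columns is never reached; it only
   makes the ambient type finite. *)
Definition in_shape (n1 n2 : nat) (b : 'I_n1 * 'I_(n1 + n2)) : bool :=
  b.1 <= b.2 < b.1 + n2.

Definition box (n1 n2 : nat) := {b : 'I_n1 * 'I_(n1 + n2) | in_shape b}.

Definition brow (n1 n2 : nat) (b : box n1 n2) : nat := (val b).1.
Definition bcol (n1 n2 : nat) (b : box n1 n2) : nat := (val b).2.

(* The label set {1, ..., n1 * n2} is represented by 'I_(n1 * n2), i.e. labels
   are shifted down by one.  The first two conjuncts say that t is bijective. *)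
Definition is_syt (n1 n2 : nat) (t : {ffun box n1 n2 -> 'I_(n1 * n2)}) : bool :=
  [&& injectiveb t,
      [forall k, k \in codom t],
      [forall b, forall b',
         (brow b == brow b') && (bcol b < bcol b') ==> (t b < t b')]
    & [forall b, forall b',
         (bcol b == bcol b') && (brow b < brow b') ==> (t b < t b')]].

Definition num_syt (n1 n2 : nat) : nat :=
  #|[set t : {ffun box n1 n2 -> 'I_(n1 * n2)} | is_syt t]|.

(* The value at (3, 1) is a convention: num_syt 3 1 is 6, because the three
   boxes of that shape are pairwise unrelated. *)
Definition g (n1 n2 : nat) : nat :=
  if (n1 == 3) && (n2 == 1) then 1 else num_syt n1 n2.

(* Main.v *)
(* Removing the largest label of a tableau gives a recurrence for the number
   e(a, b, c) of partial tableaux with a, b, c boxes in the three rows.  As long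
   as b < n, such a tableau is an ordinary shifted tableau, so e(a, b, c) is
   given by the product formula; once the second row is full, the last one is
   completed in a unique way.  Hence g_{3,n} is the sum over c < n - 1 of the
   product formulas at (n, n - 1, c), and the recurrence in n follows by creative
   telescoping. *)
Require Import Defs.
From mathcomp Require Import all_boot all_order all_algebra ring lra zify.

(** * Counting linear extensions by deleting the element with the largest label *)

Section LinearExtensions.
Set Implicit Arguments.
Unset Strict Implicit.

Variables (T : finType) (r : rel T) (N : nat) (d : 'I_N).

(* Labelings of [D] by [0, ..., k - 1] compatible with [r].  The value off [D] is
   frozen to the arbitrary [d], so that distinct labelings are distinct functions
   on [T] and all [D] share the codomain ['I_N]. *)
Definition linext (k : nat) (D : {set T}) : {set {ffun T -> 'I_N}} :=
  [set f : {ffun T -> 'I_N} |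
    [&& [forall x, (x \notin D) ==> (f x == d)],
        [forall (x | x \in D), f x < k],
        [forall (x | x \in D), forall (y | y \in D), (f x == f y) ==> (x == y)],
        [forall j : 'I_N, (j < k) ==> [exists (x | x \in D), f x == j]]
      & [forall (x | x \in D), forall (y | y \in D), r x y ==> (f x < f y)]]].

Lemma linextP k (D : {set T}) (f : {ffun T -> 'I_N}) :
  reflect [/\ forall x, x \notin D -> f x = d,
              forall x, x \in D -> f x < k,
              {in D &, injective f},
              forall j : 'I_N, j < k -> exists2 x, x \in D & f x = j
            & {in D &, forall x y, r x y -> f x < f y}]
          (f \in linext k D).
Proof.
rewrite inE; apply: (iffP and5P) => -[h1 h2 h3 h4 h5].
- split.
  + by move=> x xD; apply/eqP; move/forallP: h1 => /(_ x) /implyP; apply.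
  + exact/forall_inP.
  + move=> x y xD yD fxy; apply/eqP.
    move/forall_inP: h3 => /(_ _ xD) /forall_inP /(_ _ yD) /implyP; apply.
    exact/eqP.
  + move=> j jk; move/forallP: h4 => /(_ j) /implyP /(_ jk) /exists_inP [x xD /eqP].
    by exists x.
  + move=> x y xD yD; apply/implyP.
    by move/forall_inP: h5 => /(_ _ xD) /forall_inP /(_ _ yD).
- split.
  + by apply/forallP => x; apply/implyP => /h1 ->.
  + exact/forall_inP.
  + apply/forall_inP => x xD; apply/forall_inP => y yD; apply/implyP => /eqP fxy.
    by rewrite (h3 x y).
  + apply/forallP => j; apply/implyP => /h4 [x xD <-].
    by apply/exists_inP; exists x.
  + apply/forall_inP => x xD; apply/forall_inP => y yD; apply/implyP.
    exact: h5.
Qed.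

Lemma card_linext0 : #|linext 0 set0| = 1.
Proof.
rewrite -(cards1 [ffun _ : T => d]); apply: eq_card => f; rewrite [RHS]inE.
apply/linextP/eqP => [[h _ _ _ _]|->].
  by apply/ffunP => x; rewrite ffunE h ?inE.
by split=> // [x _|x|x y|x y]; rewrite ?ffunE ?inE.
Qed.

Definition maximal_in (D : {set T}) (x : T) : bool :=
  [forall (y | y \in D), ~~ r x y].

(** Deleting [x] resets its value to [d]; putting the label [k] back on [x] is the inverse.
    Maximality of [x] ensures that this largest label violates no relation. *)
Lemma linext_with_last k (D : {set T}) (x : T) (kN : k < N) :
  x \in D -> maximal_in D x ->
  [set f in linext k.+1 D | f x == Ordinal kN] =
  [set [ffun y => if y == x then Ordinal kN else (f : {ffun T -> 'I_N}) y]
    | f in linext k (D :\ x)].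
Proof.
move=> xD /forall_inP xmax; apply/setP => f; rewrite inE.
apply/andP/imsetP => [[/linextP [h1 h2 h3 h4 h5] /eqP fx]|[g gD ->]]; last first.
  move/linextP: gD => [h1 h2 h3 h4 h5]; split; last by rewrite ffunE eqxx.
  have glt y : y \in D -> y != x -> g y < k by move=> yD yx; rewrite h2 // !inE yx.
  apply/linextP; split.
  - move=> y yD; rewrite ffunE; case: eqP => [yx|_]; first by rewrite yx xD in yD.
    by rewrite h1 // !inE (negPf yD) andbF.
  - move=> y yD; rewrite ffunE; case: eqP => [_|/eqP yx] //.
    by rewrite ltnS ltnW ?glt.
  - move=> y z yD zD; rewrite !ffunE.
    case: (eqVneq y x) => [->|yx]; case: (eqVneq z x) => [->|zx] //.
    + by move=> e; have := glt z zD zx; rewrite -e ltnn.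
    + by move=> e; have := glt y yD yx; rewrite e ltnn.
    + by apply: h3; rewrite !inE ?yx ?zx.
  - move=> j; rewrite ltnS leq_eqVlt => /orP[/eqP jk|/h4 [y]].
      by exists x => //; rewrite ffunE eqxx; apply: val_inj.
    rewrite !inE => /andP[yx yD] <-; exists y => //.
    by rewrite ffunE (negPf yx).
  - move=> y z yD zD ryz; rewrite !ffunE.
    case: (eqVneq y x) => [yx|yx].
      by move: (xmax z zD); rewrite -yx ryz.
    case: (eqVneq z x) => [zx|zx]; first exact: glt.
    by apply: h5; rewrite ?inE ?yx ?zx.
exists [ffun y => if y == x then d else f y]; last first.
  by apply/ffunP => y; rewrite !ffunE; case: eqP => // ->.
apply/linextP; split.
- move=> y; rewrite !inE ffunE negb_and negbK.
  by case: eqP => //= _; apply: h1.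
- move=> y; rewrite !inE ffunE => /andP[yx yD]; rewrite (negPf yx).
  have := h2 y yD; rewrite ltnS leq_eqVlt => /orP[/eqP e|//].
  by case/eqP: yx; apply: h3 => //; rewrite fx; apply: val_inj.
- move=> y z; rewrite !inE !ffunE => /andP[yx yD] /andP[zx zD].
  by rewrite (negPf yx) (negPf zx); apply: h3.
- move=> j jk; have [|y yD fy] := h4 j; first exact: ltnW.
  have yx : y != x.
    by apply/eqP => yx; move: jk; rewrite -fy yx fx ltnn.
  by exists y; rewrite ?inE ?yx ?ffunE ?(negPf yx).
- move=> y z; rewrite !inE !ffunE => /andP[yx yD] /andP[zx zD].
  by rewrite (negPf yx) (negPf zx); apply: h5.
Qed.

(** The labelings are sorted by the element that carries the label [k]; this element has to be
    maximal. *)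
Lemma card_linextS k (D : {set T}) : k < N ->
  #|linext k.+1 D| = \sum_(x in D | maximal_in D x) #|linext k (D :\ x)|.
Proof.
move=> kN; set m := Ordinal kN.
have -> : #|linext k.+1 D| = \sum_(x in D) #|[set f in linext k.+1 D | f x == m]|.
  under eq_bigr => x _ do rewrite -sum1dep_card big_mkcondr.
  (* Exactly one element of [D] carries the label [m], so each labeling is counted once. *)
  rewrite exchange_big -sum1_card /=; apply: eq_bigr => f /linextP [_ _ finj fsurj _].
  have [x xD fx] := fsurj m (leqnn _).
  rewrite (bigD1 x) //= fx eqxx big1 // => y /andP[yD yx].
  case: eqP => // fy; case/eqP: yx; apply: finj => //.
  by rewrite fx.
rewrite big_mkcondr /=; apply: eq_bigr => x xD.
case: ifPn => [xmax|].
  rewrite linext_with_last // card_in_imset // => f g.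
  move=> /linextP[f0 _ _ _ _] /linextP[g0 _ _ _ _] fg.
  apply/ffunP => y; have := congr1 (fun h : {ffun T -> 'I_N} => h y) fg.
  rewrite !ffunE; case: eqP => // -> _.
  by rewrite f0 ?g0 // !inE eqxx.
rewrite negb_forall_in => /exists_inP[y yD]; rewrite negbK => rxy.
apply: eq_card0 => f; rewrite inE; apply/negP => /andP[/linextP[_ flt _ _ fr] /eqP fx].
have := fr x y xD yD rxy; have := flt y yD; rewrite fx /=; lia.
Qed.

End LinearExtensions.

(** * Tableaux as linear extensions, and removal of boxes from row-length diagrams *)

Section Shape.
Set Implicit Arguments.
Unset Strict Implicit.

Variables n1 n2 : nat.
Implicit Types (x y : box n1 n2) (l : nat -> nat) (i : nat).

Definition syt_rel : rel (box n1 n2) := fun x y =>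
  (brow x == brow y) && (bcol x < bcol y) ||
  (bcol x == bcol y) && (brow x < brow y).

Lemma num_syt_linext (d : 'I_(n1 * n2)) :
  num_syt n1 n2 = #|linext syt_rel d (n1 * n2) setT|.
Proof.
apply: eq_card => t; rewrite inE.
apply/and4P/linextP => [[/injectiveP h1 /forallP h2 h3 h4]|[_ _ h1 h2 h3]].
  split=> [x|x _|x y _ _ |j _|x y _ _].
  - by rewrite inE.
  - exact: ltn_ord.
  - exact: h1.
  - by have /codomP[x ->] := h2 j; exists x.
  - case/orP => hr.
      by move/forallP: h3 => /(_ x) /forallP /(_ y) /implyP; apply.
    by move/forallP: h4 => /(_ x) /forallP /(_ y) /implyP; apply.
split.
- by apply/injectiveP => x y; apply: h1.
- apply/forallP => k; have [x _ <-] := h2 k (ltn_ord k); exact: codom_f.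
- apply/forallP => x; apply/forallP => y; apply/implyP => hr.
  by apply: h3; rewrite // /syt_rel hr.
- apply/forallP => x; apply/forallP => y; apply/implyP => hr.
  by apply: h3; rewrite // /syt_rel hr orbT.
Qed.

(** Row [i] starts in column [i], so this is the position inside the row, and keeping an initial
    piece of each row becomes a bound on it. *)
Definition boff x : nat := bcol x - brow x.

Lemma boffK x : brow x + boff x = bcol x.
Proof. by rewrite subnKC //; case/andP: (valP x). Qed.

Lemma ltn_boff x : boff x < n2.
Proof. by rewrite -(ltn_add2l (brow x)) boffK; case/andP: (valP x). Qed.

Lemma ltn_brow x : brow x < n1.
Proof. exact: ltn_ord. Qed.

Lemma box_inj x y : brow x = brow y -> boff x = boff y -> x = y.
Proof.
move=> e eo; have ec : bcol x = bcol y by rewrite -!boffK e eo.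
by apply: val_inj; apply: injective_projections; apply: val_inj.
Qed.

Lemma box_exists i j : i < n1 -> j < n2 -> exists x, brow x = i /\ boff x = j.
Proof.
move=> lti ltj; have ltij : i + j < n1 + n2 by lia.
have P : in_shape (Ordinal lti, Ordinal ltij) by rewrite /in_shape /=; lia.
exists (exist (fun b => in_shape b) _ P).
by rewrite /boff /brow /bcol /=; split; rewrite ?addKn.
Qed.

(* [l i] is the number of boxes kept in row [i]. *)
Definition diagram l : {set box n1 n2} := [set x | boff x < l (brow x)].

Lemma eq_diagram l l' : (forall i, i < n1 -> l i = l' i) -> diagram l = diagram l'.
Proof. by move=> e; apply/setP => x; rewrite !inE e // ltn_brow. Qed.

(* The last box of row [i] has no box of the diagram below it in its column. *)
Definition removable l i : bool :=
  (0 < l i) && all (fun i' => (i' - i < l i) ==> (l i' <= (l i).-1 - (i' - i)))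
                   (iota i.+1 (n1 - i.+1)).

Definition remove l i : nat -> nat := fun j => l j - (j == i).

(** Maximality along the row singles out the last kept box. In row [i'] below, the box of the same
    column has offset smaller by [i' - brow x]; it must lie outside the diagram whenever that offset
    is not negative. *)
Lemma maximal_diagramE l x :
  (forall i, l i <= n2) ->
  (x \in diagram l) && maximal_in syt_rel (diagram l) x =
  (boff x == (l (brow x)).-1) && removable l (brow x).
Proof.
move=> ln2; rewrite inE; apply/andP/andP => [[xl /forall_inP xmax]|].
  have ox : boff x = (l (brow x)).-1.
    apply/eqP; rewrite eqn_leq andbC; apply/andP; split; last lia.
    rewrite leqNgt; apply/negP => ltx.
    have [|y [ry oy]] := @box_exists (brow x) (l (brow x)).-1 (ltn_brow x).
      have := ln2 (brow x); lia.
    have yl : y \in diagram l by rewrite inE ry oy; lia.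
    by move/negP: (xmax y yl); apply; rewrite /syt_rel -!boffK ry oy eqxx /=; lia.
  rewrite ox eqxx /removable (leq_ltn_trans _ xl) //; split=> //=.
  apply/allP => i'; rewrite mem_iota => hi'; apply/implyP => hlt.
  rewrite leqNgt; apply/negP => ltl.
  have [||y [ry oy]] := @box_exists i' ((l (brow x)).-1 - (i' - brow x)).
  - lia.
  - have := ln2 (brow x); lia.
  have yl : y \in diagram l by rewrite inE ry oy.
  by move/negP: (xmax y yl); apply; rewrite /syt_rel -!boffK ry oy ox; lia.
move=> [/eqP ox /andP[l0 /allP lrem]]; split; first by rewrite ox; lia.
apply/forall_inP => y; rewrite inE => yl; apply/negP.
rewrite /syt_rel -!boffK => /orP[/andP[/eqP e]|/andP[/eqP e lt]].
  by rewrite -e in yl *; lia.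
have /lrem : brow y \in iota (brow x).+1 (n1 - (brow x).+1).
  by rewrite mem_iota; have := ltn_brow y; lia.
by lia.
Qed.

Lemma diagram_remove l x : boff x = (l (brow x)).-1 -> 0 < l (brow x) ->
  diagram l :\ x = diagram (remove l (brow x)).
Proof.
move=> ox l0; apply/setP => y; rewrite !inE /remove.
case: (eqVneq y x) => [->|yx] /=; first by rewrite eqxx ox; lia.
case: eqP => [e|_]; last by rewrite subn0.
have : boff y != boff x by apply: contra_neq yx; apply: box_inj.
rewrite e; lia.
Qed.

Lemma card_linext_diagram (d : 'I_(n1 * n2)) k l :
  k < n1 * n2 -> (forall i, l i <= n2) ->
  #|linext syt_rel d k.+1 (diagram l)| =
  \sum_(i < n1 | removable l i) #|linext syt_rel d k (diagram (remove l i))|.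
Proof.
move=> kN ln2; rewrite card_linextS //.
under eq_bigl => x do rewrite maximal_diagramE //.
(* A removable box is determined by its row, so each class of the partition is a single box. *)
rewrite (partition_big (fun x => Ordinal (ltn_brow x))
  (fun i : 'I_n1 => removable l i)) /=; last by move=> x /andP[].
apply: eq_bigr => i irem; have l0 : 0 < l i by case/andP: irem.
have [||x [rx ox]] := @box_exists i (l i).-1; first exact: ltn_ord.
  have := ln2 i; lia.
rewrite (big_pred1 x); first by rewrite diagram_remove rx ?ox.
move=> y; rewrite /=; apply/idP/eqP => [/andP[/andP[/eqP oy _] /eqP ri]|->].
  have {}ri : brow y = i := congr1 val ri.
  by apply: box_inj; rewrite ?rx ?ri // oy ri ox.
have -> : Ordinal (ltn_brow x) = i by exact: val_inj.
by rewrite rx ox irem !eqxx.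
Qed.

End Shape.

(** * The recurrence for partial tableaux with three rows *)

Section ThreeRows.
Set Implicit Arguments.
Unset Strict Implicit.

Variables (n : nat) (d : 'I_(3 * n)).

Definition lengths (a b c i : nat) : nat := 
  match i with 0 => a | 1 => b | 2 => c | _ => 0 end.

Definition partial_syt (a b c : nat) : nat :=
  #|linext (@syt_rel 3 n) d (a + b + c) (@diagram 3 n (lengths a b c))|.

Lemma partial_syt000 : partial_syt 0 0 0 = 1.
Proof.
rewrite /partial_syt (_ : @diagram 3 n _ = set0) ?card_linext0 //.
by apply/setP => x; rewrite !inE; case: (brow x) => [|[|[|i]]].
Qed.

Lemma partial_syt_full : partial_syt n n n = num_syt 3 n.
Proof.
rewrite (num_syt_linext d) /partial_syt (_ : @diagram 3 n _ = setT); last first.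
  apply/setP => x; rewrite !inE; have := ltn_brow x; have := ltn_boff x.
  by case: (brow x) => [|[|[|i]]].
by rewrite (_ : n + n + n = 3 * n) //; lia.
Qed.

(** The summands remove the last box of the first, second and third row. The guards [1 < a], [2 < a]
    and [1 < b] say that the column of that box meets the lower row at all. *)
Lemma partial_syt_rec a b c : a <= n -> b <= n -> c <= n -> 0 < a + b + c ->
  partial_syt a b c =
    (if [&& 0 < a, (1 < a) ==> (b <= a.-1 - 1) & (2 < a) ==> (c <= a.-1 - 2)]
     then partial_syt a.-1 b c else 0)
    + (if (0 < b) && ((1 < b) ==> (c <= b.-1 - 1))
       then partial_syt a b.-1 c else 0)
    + (if 0 < c then partial_syt a b c.-1 else 0).
Proof.
move=> an bn cn; case E: (a + b + c) => [//|k] _.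
rewrite {1}/partial_syt E card_linext_diagram; last 2 first.
- lia.
- by move=> [|[|[|i]]] /=.
have eq_card_diagram l l' : (forall i, i < 3 -> l i = l' i) ->
    #|linext (@syt_rel 3 n) d k (@diagram 3 n l)| =
    #|linext (@syt_rel 3 n) d k (@diagram 3 n l')|.
  by move=> e; rewrite (eq_diagram _ e).
rewrite big_mkcond !big_ord_recl big_ord0 /= /removable /= !andbT addn0 addnA.
congr (_ + _ + _); case: ifP => // pos; rewrite /partial_syt.
- rewrite (_ : a.-1 + b + c = k); last by lia.
  by apply: eq_card_diagram => -[|[|[|i]]] //= _; rewrite /remove /= ?subn1 ?subn0.
- rewrite (_ : a + b.-1 + c = k); last by lia.
  by apply: eq_card_diagram => -[|[|[|i]]] //= _; rewrite /remove /= ?subn1 ?subn0.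
- rewrite (_ : a + b + c.-1 = k); last by lia.
  by apply: eq_card_diagram => -[|[|[|i]]] //= _; rewrite /remove /= ?subn1 ?subn0.
Qed.

End ThreeRows.

(** * The product formula: its recurrence and boundary values *)

Import GRing.Theory Num.Theory.
Local Open Scope ring_scope.

(* The product formula for shifted standard tableaux with row lengths a > b > c.
   For b = c = 0 it is 0 because of the division by b + c = 0, whereas the count
   is 1. *)
Definition hook3 (a b c : nat) : rat :=
  (a + b + c)`!%:R / (a`!%:R * b`!%:R * c`!%:R) *
  ((a%:R - b%:R) * (a%:R - c%:R) * (b%:R - c%:R)) /
  ((a%:R + b%:R) * (a%:R + c%:R) * (b%:R + c%:R)).

Lemma factr_neq0 m : m`!%:R != 0 :> rat.
Proof. by rewrite pnatr_eq0 -lt0n fact_gt0. Qed.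

Lemma factrS m : (m.+1)`!%:R = (m%:R + 1) * m`!%:R :> rat.
Proof. by rewrite factS natrM natr1. Qed.

(** After the factorials are reduced to common ones this is an identity of rational functions; the
    shifted arguments keep all denominators positive. *)
Lemma hook3_rec a b c : hook3 a.+2 b.+2 c.+1 =
  hook3 a.+1 b.+2 c.+1 + hook3 a.+2 b.+1 c.+1 + hook3 a.+2 b.+2 c.
Proof.
rewrite /hook3 (_ : a.+2 + b.+2 + c.+1 = (a + b + c).+4.+1)%N; last lia.
rewrite (_ : a.+1 + b.+2 + c.+1 = (a + b + c).+4)%N; last lia.
rewrite (_ : a.+2 + b.+1 + c.+1 = (a + b + c).+4)%N; last lia.
rewrite (_ : a.+2 + b.+2 + c = (a + b + c).+4)%N; last lia.
rewrite !factrS -!natr1 !natrD.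
field.
by rewrite !factr_neq0 ?natr1 -!natrD !pnatr_eq0 !addnS.
Qed.

Lemma hook3_rec0 a b : hook3 a.+2 b.+2 0 =
  hook3 a.+1 b.+2 0 + hook3 a.+2 b.+1 0.
Proof.
rewrite /hook3 (_ : a.+2 + b.+2 + 0 = (a + b).+4)%N; last lia.
rewrite (_ : a.+1 + b.+2 + 0 = (a + b).+3)%N; last lia.
rewrite (_ : a.+2 + b.+1 + 0 = (a + b).+3)%N; last lia.
rewrite !factrS -!natr1 !natrD.
field.
by rewrite !factr_neq0 ?natr1 -?natrD !pnatr_eq0 ?addnS.
Qed.

(** This case escapes the recurrence for [c = 0]: removing the only box of the second row leads to
    [b = c = 0], where the formula gives 0 instead of 1. *)
Lemma hook3_10 a : hook3 a.+1 1 0 = a%:R.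
Proof.
rewrite /hook3 (_ : a.+1 + 1 + 0 = a.+2)%N; last lia.
rewrite !factrS fact0 -!natr1.
field.
by rewrite !factr_neq0 ?natr1 ?pnatr_eq0.
Qed.

(** Vanishing at equal row lengths, here and in [hook3_bb], accounts for the forbidden removals. *)
Lemma hook3_aa a c : hook3 a a c = 0.
Proof. by rewrite /hook3 subrr !(mul0r, mulr0). Qed.

Lemma hook3_bb a b : hook3 a b b = 0.
Proof. by rewrite /hook3 subrr !(mul0r, mulr0). Qed.

(** * Creative telescoping in the length of the third row *)

(* Zeilberger certificate of [c |-> hook3 n n.-1 c + hook3 n.+1 n c], found by
   interpolating its partial sums. *)
Definition cert (n c : nat) : rat :=
  let x := n%:R in let y := c%:R in
  y * (2 * n + c).-1`!%:R / c`!%:R *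
  ((x * (-5 - 17 * x + 25 * x ^+ 2 + 35 * x ^+ 3 + 10 * x ^+ 4))
   + (-1 - 11 * x + 32 * x ^+ 2 - 6 * x ^+ 3 - 12 * x ^+ 4) * y
   + (-2 + 23 * x - 18 * x ^+ 2 - 4 * x ^+ 3) * y ^+ 2
   + (4 - 10 * x + 4 * x ^+ 2) * y ^+ 3
   + (2 * x - 1) * y ^+ 4)
  / ((y + x) * (y + x - 1) * n`!%:R * (n.+1)`!%:R
     * (2 * x - 1) * (2 * x + 1) * (2 * (x + 1))).

Lemma certP p c :
  hook3 p.+2 p.+1 c + hook3 p.+3 p.+2 c = cert p.+2 c.+1 - cert p.+2 c.
Proof.
rewrite /hook3 /cert.
rewrite (_ : p.+2 + p.+1 + c = (2 * p + c).+3)%N; last lia.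
rewrite (_ : p.+3 + p.+2 + c = (2 * p + c).+4.+1)%N; last lia.
rewrite (_ : (2 * p.+2 + c.+1).-1 = (2 * p + c).+4)%N; last lia.
rewrite (_ : (2 * p.+2 + c).-1 = (2 * p + c).+3)%N; last lia.
rewrite !factrS -!natr1 !natrD ?natrM.
field.
have := ler0n rat p; have := ler0n rat c => c0 p0.
do ?[apply/andP; split]; rewrite ?factr_neq0 //; apply: lt0r_neq0; lra.
Qed.

Lemma sum_hook3 p m :
  \sum_(0 <= c < m) (hook3 p.+2 p.+1 c + hook3 p.+3 p.+2 c) = cert p.+2 m.
Proof.
rewrite (telescope_sumr_eq (cert p.+2)) //.
  (* The factor [y] of the certificate makes it vanish at [c = 0]. *)
  by rewrite {2}/cert !mul0r subr0.
by move=> c _; rewrite certP.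
Qed.

(** At [c = n] the certificate collapses to the inhomogeneous term of the theorem; both sides are
    compared through factorials. *)
Lemma cert_diag p :
  cert p.+2 p.+2 =
    (7 * p.+2%:R + 1) / (p.+2%:R ^+ 2 * (p.+2%:R + 1) ^+ 2)
      * 'C(2 * p.+2 - 2, p.+2 - 1)%:R * 'C(3 * p.+2, p.+2 - 1)%:R.
Proof.
have bf m k : (k <= m)%N -> 'C(m, k)%:R = m`!%:R / (k`!%:R * (m - k)`!%:R) :> rat.
  move=> km; rewrite -(bin_fact km) !natrM mulfK // mulf_neq0 ?factr_neq0 //.
rewrite !bf; try lia.
rewrite (_ : 2 * p.+2 - 2 - (p.+2 - 1) = p.+1)%N; last lia.
rewrite (_ : 3 * p.+2 - (p.+2 - 1) = (2 * p).+4.+1)%N; last lia.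
rewrite (_ : 2 * p.+2 - 2 = (2 * p).+2)%N; last lia.
rewrite (_ : 3 * p.+2 = (3 * p).+4.+2)%N; last lia.
rewrite (_ : p.+2 - 1 = p.+1)%N; last lia.
rewrite /cert.
rewrite (_ : (2 * p.+2 + p.+2).-1 = (3 * p).+4.+1)%N; last lia.
rewrite !factrS -!natr1 !natrM.
field.
have := ler0n rat p => p0.
do ?[apply/andP; split]; rewrite ?factr_neq0 //; apply: lt0r_neq0; lra.
Qed.

(** * Solving the recurrence, for any [e] that satisfies it *)

Section ThreeRowsCount.

Variables (n : nat) (e : nat -> nat -> nat -> nat).

Hypothesis e000 : e 0 0 0 = 1%N.

Hypothesis e_rec : forall a b c,
  (a <= n)%N -> (b <= n)%N -> (c <= n)%N -> (0 < a + b + c)%N ->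
  e a b c =
    ((if [&& 0 < a, (1 < a) ==> (b <= a.-1 - 1) & (2 < a) ==> (c <= a.-1 - 2)]
      then e a.-1 b c else 0)
     + (if (0 < b) && ((1 < b) ==> (c <= b.-1 - 1)) then e a b.-1 c else 0)
     + (if 0 < c then e a b c.-1 else 0))%N.

Lemma count_row a : (a <= n)%N -> e a 0 0 = 1%N.
Proof.
elim: a => [_|a IH an]; first exact: e000.
by rewrite e_rec // IH; [rewrite !leq0n !implybT | apply: ltnW].
Qed.

Lemma count_hook3 a b c : (c < b < a)%N -> (a <= n)%N ->
  (e a b c)%:R = hook3 a b c.
Proof.
have [k] := ubnP (a + b + c)%N; elim: k a b c => // k IH a b c abck.
case: b abck => [|b] abck; first by rewrite ltn0.
case: a abck => [|[|a]] abck; [by rewrite andbF | by rewrite !ltnS ltn0 andbF |].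
move=> /andP[cb ba] an.
(* If the first row may not lose a box, then its shortened length equals that of the second row and
   the product formula is 0; [second_term] treats the next pair of rows likewise. *)
have first_term : (if (b.+1 <= a)%N then e a.+1 b.+1 c else 0%N)%:R
                  = hook3 a.+1 b.+1 c.
  case: ifP => hab; first by apply: IH; lia.
  by rewrite (_ : b = a) ?hook3_aa //; lia.
rewrite e_rec //; try lia.
rewrite (_ : [&& _, _ & _] = (b.+1 <= a)%N); last lia.
rewrite !natrD first_term {first_term}.
(* With a second row of one box, the third is empty and the count grows by the single tableau of one
   row. *)
case: b => [|b] in abck cb ba *.
  case: c => // in abck cb *.
  by rewrite /= count_row // addr0 !hook3_10 -[RHS]natr1.
have second_term : (if (0 < b.+2)%N && ((1 < b.+2) ==> (c <= b.+2.-1 - 1))%N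
    then e a.+2 b.+2.-1 c else 0%N)%:R = hook3 a.+2 b.+1 c.
  case: ifP => /= hbc; first by apply: IH; lia.
  by rewrite (_ : c = b.+1) ?hook3_bb //; lia.
rewrite second_term {second_term}.
case: c => [|c] in abck cb *; first by rewrite /= addr0 hook3_rec0.
by rewrite hook3_rec /=; congr (_ + _); apply: IH; lia.
Qed.


(* Once the second row is full, the third one is unconstrained. *)
Lemma count_full p : n = p.+2 ->
  (e n n n)%:R = \sum_(0 <= c < p.+2) hook3 p.+2 p.+1 c.
Proof.
move=> np; rewrite np.
(* The full second row blocks every removal from the first. *)
have step c : (c <= p.+2)%N -> e p.+2 p.+2 c =
    ((if (c <= p)%N then e p.+2 p.+1 c else 0)
     + (if (0 < c)%N then e p.+2 p.+2 c.-1 else 0))%N.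
  move=> cp; rewrite e_rec ?np // (_ : [&& _, _ & _] = false); last lia.
  by rewrite add0n /= subn1.
have partial_sum c : (c < p.+2)%N ->
    (e p.+2 p.+2 c)%:R = \sum_(0 <= j < c.+1) hook3 p.+2 p.+1 j.
  have term j : (j < p.+2)%N ->
      (if (j <= p)%N then e p.+2 p.+1 j else 0)%:R = hook3 p.+2 p.+1 j.
    move=> jp; case: ifP => hjp; first by apply: count_hook3; lia.
    by rewrite (_ : j = p.+1) ?hook3_bb //; lia.
  elim: c => [|c IH] cp; rewrite step ?natrD ?term //; try lia.
    by rewrite big_nat1 addr0 -[RHS]term.
  by rewrite [RHS]big_nat_recr //= -IH 1?ltnW // addrC.
(* At [c = n] only the third row can lose a box, so the sum stops growing at [c = n - 1]. *)
by rewrite step // ltnNge leqnSn /= add0n partial_sum.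
Qed.

End ThreeRowsCount.

(** * The recurrence in [n] for the tableau numbers *)

Lemma num_syt3 p :
  (num_syt 3 p.+2)%:R = \sum_(0 <= c < p.+2) hook3 p.+2 p.+1 c.
Proof.
have d : 'I_(3 * p.+2) by exact: ord0.
rewrite -(partial_syt_full d); apply: count_full => //.
  exact: partial_syt000.
exact: partial_syt_rec.
Qed.

Theorem theorem1 (n : nat) (hn : (1 <= n)%N) :
  (g 3 n.+1)%:R =
    - (g 3 n)%:R
    + (7 * n%:R + 1) / (n%:R ^+ 2 * (n%:R + 1) ^+ 2)
      * 'C(2 * n - 2, n - 1)%:R * 'C(3 * n, n - 1)%:R :> rat.
Proof.
case: n hn => [//|[_|p _]].
  (* For [n = 1] the convention g_{3,1} = 1 enters, and the identity reads 1 = -1 + 2. *)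
  rewrite /g /= num_syt3 big_nat_recr //= big_nat1 hook3_10 hook3_bb.
  by rewrite bin0.
rewrite /g /= !num_syt3 -cert_diag -sum_hook3 big_split /=.
(* The sum for [n + 1] has one more term, at [c = n], and this term vanishes. *)
by rewrite (big_nat_recr p.+2) //= hook3_bb addr0 addKr.
Qed.
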